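(* Let $(a_n)_{n \geq 1}$ be a strictly increasing sequence of positive integers. For every $\varepsilon > 0$ and almost all $\alpha \in [0,1]$ (with respect to Lebesgue measure), $$\delta_{\min}^{\alpha}(N) \leq \frac{N^{\varepsilon}}{C_N} \qquad \text{for all except finitely many } N.$$
   Context: For $\alpha \in [0,1]$ and $N \geq 2$, $\delta_{\min}^{\alpha}(N) = \min\{\|(a_m - a_n)\alpha\| : 1 \leq m,n \leq N,\ m \neq n\}$, where $\|x\|$ denotes the distance from $x$ to the nearest integer. Let $A_N = \{a_1,\dots,a_N\}$, $A_N - A_N = \{a-b : a,b \in A_N\}$, and $C_N = \#(A_N - A_N)$. *)

(* Defs.v *)
From HB Require Import structures.
From mathcomp Require Import all_boot all_order all_algebra.
From mathcomp Require Import all_classical all_reals all_analysis.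
Set Implicit Arguments. Unset Strict Implicit. Unset Printing Implicit Defensive.
Import Order.TTheory GRing.Theory Num.Theory.
Local Open Scope ring_scope.

Definition distZ {R : realType} (x : R) : R :=
  Num.min (x - (Num.floor x)%:~R) ((Num.floor x)%:~R + 1 - x).

(* delta_min^alpha(N) = min over 1 <= m, n <= N, m <> n of ||(a_m - a_n) alpha||.
   (For N >= 2 the range is nonempty; the default 1 is never attained then
   since distZ <= 1/2.) *)
Definition delta_min {R : realType} (a : nat -> nat) (alpha : R) (N : nat) : R :=
  \big[Num.min/1]_(m <- iota 1 N)
    \big[Num.min/1]_(n <- iota 1 N | m != n)
       distZ (((a m)%:R - (a n)%:R) * alpha).

Definition C_N (a : nat -> nat) (N : nat) : nat :=
  size (undup [seq ((a m)%:Z - (a n)%:Z)%R | m <- iota 1 N, n <- iota 1 N]).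

(* Main.v *)
Require Import Defs.
From HB Require Import structures.
From mathcomp Require Import all_boot all_order all_algebra zify ring lra.
From mathcomp Require Import all_classical all_reals all_analysis.
From mathcomp Require complex.
Set Implicit Arguments. Unset Strict Implicit. Unset Printing Implicit Defensive.
Import Order.TTheory GRing.Theory Num.Theory numFieldNormedType.Exports.
Local Open Scope classical_set_scope.

(** Let D be the set of positive differences of a_1, ..., a_N and M = #D, so that
    C_N = 2M + 1. If P >= 0 is a trigonometric polynomial of degree < L = M^(1-c)
    which is tiny outside [-delta, delta] mod 1 (a high power of a Fejer kernel),
    then sum_(d in D) P(d alpha) is far from its mean as soon as no d alpha is
    within delta of an integer. Its variance is controlled by the number of
    solutions of d h = d' h' with d, d' in D and h, h' < L. Iterated
    Cauchy-Schwarz replaces h by products of p = 2^s integers < L; for these the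
    divisor bound gives O((M L)^(1 + 1/p)) solutions (a weak form of the GCD sum
    bounds of Gal). Chebyshev's inequality and the Borel-Cantelli lemma along a
    sequence of N for which M grows geometrically conclude. *)

(** * Divisor bound *)

(** Raise [e + 1 <= k * (e %/ k + 1) <= k * 2 ^ (e %/ k)] to the power [k]. *)
Lemma succn_expn_le k e : 0 < k -> e.+1 ^ k <= k ^ k * 2 ^ e.
Proof.
move=> k_gt0; have le_e : e.+1 <= k * (e %/ k).+1.
  by rewrite mulnS mulnC addnC {1}(divn_eq e k) -addnS leq_add2l ltn_mod.
apply: leq_trans (_ : (k * 2 ^ (e %/ k)) ^ k <= _).
  by rewrite leq_exp2r // (leq_trans le_e) // leq_mul2l ltn_expl // orbT.
by rewrite expnMn -expnM leq_mul2l leq_exp2l // leq_trunc_div orbT.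
Qed.

(** A divisor [d] is recovered from the exponent of [p] in [gcdn d (p ^ e)] and the cofactor, which
    divides [m]. *)
Lemma size_divisors_pfactorM p e m : prime p -> 0 < m ->
  size (divisors (p ^ e * m)) <= e.+1 * size (divisors m).
Proof.
move=> p_pr m_gt0; have p_gt0 := prime_gt0 p_pr.
have n_gt0 : 0 < p ^ e * m by rewrite muln_gt0 expn_gt0 p_gt0.
rewrite -[e.+1](size_iota 0) -(size_allpairs (fun i d => p ^ i * d)).
apply: uniq_leq_size (divisors_uniq _) _ => d.
rewrite -dvdn_divisors // => d_dv.
have d_gt0 : 0 < d by apply: dvdn_gt0 n_gt0 d_dv.
have [g gE] : exists g, g = gcdn d (p ^ e) by exists (gcdn d (p ^ e)).
have [i le_ie gi] : exists2 i, i <= e & g = p ^ i.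
  by apply/(dvdn_pfactor _ _ p_pr); rewrite gE dvdn_gcdr.
have g_gt0 : 0 < g by rewrite gi expn_gt0 p_gt0.
have gd : g %| d by rewrite gE dvdn_gcdl.
apply/allpairsP; exists (i, d %/ g); split.
- by rewrite mem_iota add0n ltnS.
- rewrite /= -dvdn_divisors // -(@dvdn_pmul2l g) // mulnC divnK //.
  rewrite gE muln_gcdl dvdn_gcd dvdn_mulr //= mulnC.
- by rewrite /= -gi mulnC divnK.
Qed.

(** An integer form of tau(n) = O(n^(1/k)). Primes [p >= 2 ^ k] satisfy [(e + 1) ^ k <= p ^ e]
    because [e + 1 <= 2 ^ e]; each of the at most [2 ^ k] smaller primes costs a factor [k ^ k]. *)
Lemma size_divisors_expn_le k n : 0 < k -> 0 < n ->
  size (divisors n) ^ k <= (k ^ k) ^ (2 ^ k) * n.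
Proof.
move=> k_gt0 n_gt0.
have kk_gt0 : 0 < k ^ k by rewrite expn_gt0 k_gt0.
suff: size (divisors n) ^ k <= (k ^ k) ^ count (fun p => p < 2 ^ k) (primes n) * n.
  move/leq_trans; apply; rewrite leq_mul2r; apply/orP; right; rewrite leq_pexp2l //.
  rewrite -size_filter -[leqRHS](size_iota 0); apply: uniq_leq_size.
    by rewrite filter_uniq // primes_uniq.
  by move=> p; rewrite mem_filter mem_iota => /andP[].
elim/ltn_ind: n n_gt0 => n IHn n_gt0.
have [n_le1|n_gt1] := leqP n 1.
  have -> : n = 1 by apply/eqP; rewrite eqn_leq n_le1.
  by rewrite /= exp1n.
pose p := pdiv n; have p_pr : prime p by rewrite pdiv_prime.
have p_gt0 := prime_gt0 p_pr.
pose e := logn p n; pose m := n %/ p ^ e.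
have nE : n = p ^ e * m by rewrite mulnC divnK // pfactor_dvdnn.
have m_gt0 : 0 < m by move: n_gt0; rewrite nE muln_gt0 => /andP[].
have e_gt0 : 0 < e by rewrite logn_gt0 mem_primes p_pr n_gt0 pdiv_dvd.
have cpm : coprime p m.
  by rewrite prime_coprime // -(@dvdn_pmul2l (p ^ e)) ?expn_gt0 ?p_gt0 // -expnSr
    -nE pfactor_dvdn // ltnn.
have lt_mn : m < n by rewrite nE ltn_Pmull // -(exp1n e) ltn_exp2r // prime_gt1.
have {}IHn := IHn m lt_mn m_gt0.
have primesn : perm_eq (primes n) (p :: primes m).
  apply: uniq_perm; rewrite ?primes_uniq //=.
    by rewrite primes_uniq andbT mem_primes p_pr m_gt0 /= -prime_coprime.
  move=> x; rewrite in_cons {1}nE primesM ?expn_gt0 ?p_gt0 //.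
  by rewrite primesX // primes_prime // inE.
rewrite (permP primesn) /=.
have step : e.+1 ^ k <= (k ^ k) ^ (p < 2 ^ k) * p ^ e.
  case: ltnP => le_p.
    rewrite expn1 (leq_trans (succn_expn_le e k_gt0)) // leq_mul2l.
    by rewrite leq_exp2r ?prime_gt1 ?orbT.
  rewrite mul1n (leq_trans (_ : _ <= (2 ^ e) ^ k)) //.
    by rewrite leq_exp2r // ltn_expl.
  by rewrite -expnM mulnC expnM leq_exp2r.
rewrite {1}nE (leq_trans (_ : _ <= (e.+1 * size (divisors m)) ^ k)) //.
  by rewrite leq_exp2r // size_divisors_pfactorM.
rewrite expnMn expnD [X in _ <= _ * X]nE mulnACA; exact: leq_mul.
Qed.

(** * Cauchy-Schwarz and multiplicative energy *)

Lemma sqr_sum_le (R : realDomainType) (I : Type) (r : seq I) (w : I -> R) :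
  ((\sum_(i <- r) w i) ^+ 2 <= (size r)%:R * \sum_(i <- r) w i ^+ 2)%R.
Proof.
rewrite -(ler_pM2l (_ : 0 < 2 :> R)%R) // expr2 big_distrlr /=.
have -> : (2 * ((size r)%:R * \sum_(i <- r) w i ^+ 2) =
    \sum_(i <- r) \sum_(j <- r) (w i ^+ 2 + w j ^+ 2))%R.
  under [RHS]eq_bigr => i _ do
    rewrite big_split /= big_const_seq count_predT iter_addr_0.
  rewrite big_split /= big_const_seq count_predT iter_addr_0 sumrMnl.
  by rewrite -mulr2n !mulr_natl.
rewrite big_distrr /=; apply: ler_sum => i _; rewrite big_distrr /=.
apply: ler_sum => j _; have := sqr_ge0 (w i - w j)%R; lra.
Qed.

Lemma sqr_sumn_le (I : Type) (r : seq I) (w : I -> nat) :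
  (\sum_(i <- r) w i) ^ 2 <= size r * \sum_(i <- r) w i ^ 2.
Proof.
rewrite -(ler_nat int) natrX natrM !natr_sum.
under [X in (_ <= _ * X)%R]eq_bigr => i _ do rewrite natrX.
exact: sqr_sum_le.
Qed.

Definition energy (D P : seq nat) : nat :=
  \sum_(d <- D) \sum_(e <- D) \sum_(x <- P) \sum_(y <- P) (d * x == e * y).

(** Repetitions are kept, so that [energy] weighs each value by its number of factorisations. *)
Definition prods (P : seq nat) : seq nat := [seq x * y | x <- P, y <- P].

Lemma sum_mul_sums (I J K : Type) (r : seq I) (s : seq J) (t : seq K)
    (a : I -> J -> nat) (b : I -> K -> nat) :
  \sum_(i <- r) (\sum_(j <- s) a i j) * (\sum_(k <- t) b i k) =
  \sum_(j <- s) \sum_(k <- t) \sum_(i <- r) a i j * b i k.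
Proof.
under eq_bigr => i _ do rewrite big_distrlr /=.
by rewrite exchange_big /=; apply: eq_bigr => j _; rewrite exchange_big.
Qed.

(** Cauchy-Schwarz over [d] gives pairs of equations [d * x = e * y], [d * u = f * v]. Eliminating
    [d] leaves [e * (u * y) = f * (x * v)], a solution for [prods P], and [d] is recovered as
    [(e * y) %/ x]. *)
Lemma sqr_energy_le (D P : seq nat) : uniq D -> all (leq 1) P ->
  energy D P ^ 2 <= size D * energy D (prods P).
Proof.
move=> uD P_gt0; apply: leq_trans (sqr_sumn_le _ _) _; rewrite leq_mul2l.
apply/orP; right.
under eq_bigr => d _ do rewrite -mulnn.
rewrite sum_mul_sums; apply: leq_sum => e _; apply: leq_sum => f _.
rewrite sum_mul_sums big_allpairs_dep.
under [leqRHS]eq_bigr => u _ do under eq_bigr => y _ do rewrite big_allpairs_dep.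
under [leqRHS]eq_bigr => u _ do rewrite exchange_big.
rewrite [leqRHS]exchange_big /= !big_seq; apply: leq_sum => x xP.
have x_gt0 : 0 < x by exact: (allP P_gt0).
apply: leq_sum => u _; rewrite sum_mul_sums; apply: leq_sum => y _.
apply: leq_sum => v _; have [eq_ef|ne_ef] := eqVneq (e * (u * y)) (f * (x * v)).
  apply: leq_trans (_ : \sum_(d <- D) (d == (e * y) %/ x) <= _).
    apply: leq_sum => d _; case: (eqVneq (d * x)) => [<-|//].
    by rewrite mulnK // eqxx mul1n leq_b1.
  by rewrite -big_mkcond sum1_count /= count_uniq_mem // leq_b1.
rewrite big1 // => d _.
case: eqP => // dx; case: eqP => // du; case/eqP: ne_ef.
by rewrite [u * y]mulnC mulnA -dx mulnAC du -mulnA [v * x]mulnC.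
Qed.

Lemma prods_gt0 (P : seq nat) : all (leq 1) P -> all (leq 1) (prods P).
Proof.
move=> /allP P_gt0; apply/allP => _ /allpairsP[[x y] /= [xP yP ->]].
by rewrite muln_gt0 !P_gt0.
Qed.

Lemma iter_prods_gt0 (P : seq nat) s :
  all (leq 1) P -> all (leq 1) (iter s prods P).
Proof. by move=> P_gt0; elim: s => //= s; exact: prods_gt0. Qed.

Lemma size_iter_prods (P : seq nat) s :
  size (iter s prods P) = size P ^ (2 ^ s).
Proof.
by elim: s => //= s IHs; rewrite size_allpairs IHs -expnD expnS mul2n addnn.
Qed.

Lemma iter_prods_le (P : seq nat) L s x : {in P, forall y, y <= L} ->
  x \in iter s prods P -> x <= L ^ (2 ^ s).
Proof.
move=> leP; elim: s x => [|s IHs] x /=; first exact: leP.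
case/allpairsP => [[y z] /= [/IHs yP /IHs zP ->]].
by rewrite expnS mul2n -addnn expnD leq_mul.
Qed.

Lemma energy_iter_le (D P : seq nat) s : uniq D -> all (leq 1) P ->
  energy D P ^ (2 ^ s) <= size D ^ (2 ^ s).-1 * energy D (iter s prods P).
Proof.
move=> uD P_gt0; elim: s => [|s IHs]; first by rewrite expn0 mul1n.
have -> : (2 ^ s.+1).-1 = ((2 ^ s).-1 * 2).+1.
  by rewrite expnSr; have : 0 < 2 ^ s by [rewrite expn_gt0]; lia.
rewrite expnSr expnM; apply: leq_trans (_ : _ <= (_ * _) ^ 2) _.
  by rewrite leq_exp2r //; exact: IHs.
rewrite expnMn -expnM [X in _ <= X * _]expnSr -mulnA leq_mul2l; apply/orP; right.
exact/sqr_energy_le/iter_prods_gt0.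
Qed.

(** A product of [2 ^ s] factors is a binary tree with [2 ^ s - 1] inner nodes; at each node the
    left factor is one of at most [T] divisors. *)
Lemma count_iter_prods_le (P : seq nat) (T Q s n : nat) :
  uniq P -> all (leq 1) P ->
  (forall m, 0 < m <= Q -> size (divisors m) <= T) -> 0 < n <= Q ->
  count_mem n (iter s prods P) <= T ^ (2 ^ s).-1.
Proof.
move=> uP P_gt0 divT; elim: s n => [|s IHs] n /andP[n_gt0 le_nQ].
  by rewrite /= count_uniq_mem // leq_b1.
rewrite /=; set W := iter s prods P in IHs *; set B := T ^ _ in IHs.
have -> : T ^ (2 ^ s.+1).-1 = T * B * B.
  rewrite -mulnA -expnD -expnS; congr (_ ^ _).
  by rewrite expnSr; have : 0 < 2 ^ s by [rewrite expn_gt0]; lia.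
have dvQ d : d %| n -> 0 < d <= Q.
  by move=> dn; rewrite (dvdn_gt0 n_gt0 dn) (leq_trans (dvdn_leq n_gt0 dn)).
rewrite -sum1_count big_mkcond big_allpairs_dep /=.
apply: leq_trans (_ : \sum_(x <- W) (x %| n) * B <= _).
  apply: leq_sum => x _; case: (boolP (x %| n)) => [x_n|x_n]; last first.
    rewrite big1 // => y _; case: eqP => // xy.
    by case/negP: x_n; rewrite -xy dvdn_mulr.
  have x_gt0 : 0 < x by case/andP: (dvQ _ x_n).
  have nx := dvdn_div x_n; rewrite mul1n (leq_trans _ (IHs _ (dvQ _ nx))) //.
  rewrite -sum1_count [leqRHS]big_mkcond /=; apply: leq_sum => y _.
  by case: (x * y =P n) => // <-; rewrite mulKn // eqxx.
rewrite -big_distrl leq_mul2r; apply/orP; right.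
apply: leq_trans (_ : \sum_(d <- divisors n) count_mem d W <= _).
  under [leqRHS]eq_bigr => d _ do rewrite -sum1_count big_mkcond.
  rewrite exchange_big /=; apply: leq_sum => x _.
  case: (boolP (x %| n)) => // x_n; rewrite -big_mkcond sum1_count.
  rewrite -(@eq_count _ (pred1 x)); last by move=> d /=; rewrite eq_sym.
  by rewrite count_uniq_mem ?divisors_uniq // -dvdn_divisors ?x_n.
apply: leq_trans (_ : \sum_(d <- divisors n) B <= _).
  by rewrite !big_seq; apply: leq_sum => d; rewrite -dvdn_divisors // => /dvQ /IHs.
rewrite big_const_seq count_predT iter_addn_0 mulnC leq_mul2r divT ?orbT //.
by rewrite n_gt0.
Qed.

(** Once [d], [e] and [x] are fixed, the value of [y] is forced, and it occurs at most [B] times in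
    [P]. *)
Lemma energy_le (D P : seq nat) (B : nat) : all (leq 1) D ->
  {in P, forall n, count_mem n P <= B} ->
  energy D P <= size D ^ 2 * (size P * B).
Proof.
move=> D_gt0 countP; rewrite -mulnn -mulnA mulnC.
have sumC (r : seq nat) c : \sum_(i <- r) c = c * size r.
  by rewrite big_const_seq count_predT iter_addn_0.
rewrite -mulnA -!sumC mulnC -sumC.
rewrite /energy; apply: leq_sum => d _; rewrite !big_seq; apply: leq_sum => e eD.
rewrite mulnC -sumC; apply: leq_sum => x _.
have e_gt0 : 0 < e by exact: (allP D_gt0).
case: (boolP ((d * x) %/ e \in P)) => [/countP|nP].
  apply: leq_trans; rewrite -sum1_count [leqRHS]big_mkcond /=; apply: leq_sum => y _.
  by case: (d * x =P e * y) => // ->; rewrite mulKn // eqxx.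
rewrite big_seq big1 // => y yP; case: eqP => // dx; case/negP: nP.
by rewrite dx mulKn.
Qed.

(* The exponent [2 ^ s] plays the role of the Hoelder exponent p; the divisor
   bound is used with k = p ^ 2, so that it costs only one extra factor L. *)
Lemma energy_iota_le s : exists C, forall (D : seq nat) (L : nat),
  uniq D -> all (leq 1) D ->
  energy D (iota 1 L) ^ (2 ^ s) <= C * (size D * L) ^ (2 ^ s).+1.
Proof.
set p := 2 ^ s; have p_gt0 : 0 < p by rewrite expn_gt0.
pose k := p * p; pose C := (k ^ k) ^ (2 ^ k).
have k_gt0 : 0 < k by rewrite muln_gt0 p_gt0.
have C_gt0 : 0 < C by rewrite !expn_gt0 k_gt0.
exists C => D L uD D_gt0; have [->|L_gt0] := posnP L.
  rewrite [energy _ _]big1 ?exp0n // => d _; rewrite big1 // => e _.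
  exact: big_nil.
have iota_gt0 : all (leq 1) (iota 1 L).
  by apply/allP => x; rewrite mem_iota => /andP[].
pose Q := L ^ p; have Q_gt0 : 0 < Q by rewrite expn_gt0 L_gt0.
have [T [divT TC]] : exists T,
    (forall m, 0 < m <= Q -> size (divisors m) <= T) /\ T ^ k <= C * Q.
  pose T := \max_(i < Q) size (divisors i.+1); exists T; split.
    move=> [//|m] /= lt_mQ.
    exact: (@leq_bigmax _ (fun i : 'I_Q => size (divisors i.+1)) (Ordinal lt_mQ)).
  have [|i Ti] := @bigop.eq_bigmax _ (fun i : 'I_Q => size (divisors i.+1)).
    by rewrite card_ord.
  rewrite /T Ti (leq_trans (size_divisors_expn_le k_gt0 _)) //.
  by rewrite leq_mul2l ltn_ord orbT.
(* Since [k = p ^ 2] and [Q = L ^ p], this is a [p]-th root of the bound on [T ^ k], with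
   [C <= C ^ p]. *)
have {TC} TC : T ^ p <= C * L.
  rewrite -(@leq_exp2r _ _ p) // -expnM (leq_trans TC) // expnMn.
  by rewrite leq_mul2r -{1}[C]expn1 leq_pexp2l // orbT.
have T_gt0 : 0 < T by apply: leq_trans (divT 1 _); rewrite ?Q_gt0.
apply: leq_trans (energy_iter_le s uD iota_gt0) _.
have /(energy_le D_gt0) : {in iter s prods (iota 1 L),
    forall n, count_mem n (iter s prods (iota 1 L)) <= T ^ p.-1}.
  move=> n nP; apply: (@count_iter_prods_le _ _ Q) => //; first exact: iota_uniq.
  rewrite (allP (iter_prods_gt0 s iota_gt0)) //=.
  by apply: iter_prods_le nP => y; rewrite mem_iota add1n ltnS => /andP[].
rewrite size_iter_prods size_iota -/p => le_en.
apply: leq_trans (leq_mul (leqnn _) le_en) _.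
rewrite mulnA -expnD (_ : p.-1 + 2 = p.+1); last by lia.
rewrite expnMn [C * _]mulnC -mulnA leq_mul2l; apply/orP; right.
rewrite expnSr -mulnA leq_mul2l [L * C]mulnC; apply/orP; right.
by apply: leq_trans TC; rewrite leq_pexp2l // leq_pred.
Qed.

Local Open Scope ring_scope.

(** * Powers of the Fejer kernel *)

Section Kernel.
Import complex.
Variable R : realType.
Implicit Types (t : R) (p : {poly R}) (m : nat -> R).

Definition cis t : complex R := Complex (cos t) (sin t).

(** The squared modulus, valued in [R] rather than in the complex field. *)
Definition csqr (z : complex R) : R := complex.Re z ^+ 2 + complex.Im z ^+ 2.

Lemma csqrM z w : csqr (z * w) = csqr z * csqr w.
Proof. by case: z w => [a b] [c d]; rewrite /csqr /=; ring. Qed.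

Lemma csqrX z n : csqr (z ^+ n) = csqr z ^+ n.
Proof.
elim: n => [|n IHn]; last by rewrite !exprS csqrM IHn.
by rewrite /csqr /=; ring.
Qed.

Lemma cisX t n : cis t ^+ n = cis (n%:R * t).
Proof.
elim: n => [|n IHn]; first by rewrite mul0r /cis cos0 sin0.
rewrite exprSr IHn -natr1 mulrDl mul1r /cis cosD sinD.
by congr Complex; rewrite [RHS]addrC // [cos t * _]mulrC [sin t * _]mulrC addrC.
Qed.

Lemma csqr_cis_sub1 t : csqr (cis t - 1) = 2 - 2 * cos t.
Proof.
have := cos2Dsin2 t; rewrite /csqr /cis /= => cs.
by rewrite oppr0 addr0; lra.
Qed.

(** Since cos is even, the frequencies can be natural numbers, as in the orthogonality relations
    below. *)
Lemma csqr_horner_cis p n t : (size p <= n)%N ->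
  csqr (map_poly (real_complex R) p).[cis t] =
  \sum_(u < n) \sum_(v < n) p`_u * p`_v * cos (`|u - v|%N%:R * t).
Proof.
move=> szp; rewrite (@horner_coef_wide _ n); last by rewrite size_map_poly.
have -> : \sum_(i < n) (map_poly (real_complex R) p)`_i * cis t ^+ i =
   Complex (\sum_(i < n) p`_i * cos (i%:R * t)) (\sum_(i < n) p`_i * sin (i%:R * t)).
  elim/big_ind3 : _ => // [? ? ? ? ? ? -> ->|i _] //.
  rewrite cisX coef_map /=; congr Complex; rewrite /=; ring.
rewrite /csqr /= !expr2 !big_distrlr /= -big_split /=; apply: eq_bigr => u _.
rewrite -big_split /=; apply: eq_bigr => v _.
rewrite mulrACA [X in _ + X]mulrACA -mulrDr; congr (_ * _).
rewrite -cosB -mulrBl.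
have [le_uv|/ltnW le_vu] := leqP u v.
  by rewrite distnEr // natrB // -cosN -mulNr opprB.
by rewrite distnEl // natrB.
Qed.

Lemma sum_ord_eq_le1 n c : \sum_(v < n) (v == c :> nat)%:R <= 1 :> R.
Proof.
rewrite -natr_sum (_ : 1 = 1%:R) // ler_nat.
have [lt_cn|le_nc] := ltnP c n.
  rewrite (bigD1 (Ordinal lt_cn)) //= eqxx big1 // => v.
  by rewrite -val_eqE /= => /negPf ->.
by rewrite big1 // => v _; rewrite (ltn_eqF (leq_trans (ltn_ord v) le_nc)).
Qed.

Lemma sum_ord_distn_le2 (n u h : nat) :
  \sum_(v < n) (`|u - v|%N == h)%:R <= 2 :> R.
Proof.
apply: (@le_trans _ _ (\sum_(v < n) ((v == (u + h)%N :> nat)%:R + (v == (u - h)%N :> nat)%:R))).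
  apply: ler_sum => v _; rewrite -natrD ler_nat.
  case: eqP => // uv; case: eqP => [|v1]; case: eqP => // v2; exfalso; lia.
rewrite big_split /= (_ : 2 = 1 + 1) //; apply: lerD; exact: sum_ord_eq_le1.
Qed.

(** The coefficient of [cos (h t)] in the squared modulus of the polynomial with coefficients [m];
    for [h > 0] it collects both signs of [u - v]. *)
Definition autocorr m L h : R :=
  \sum_(u < L) \sum_(v < L) m u * m v * (`|u - v|%N == h)%:R.

Lemma autocorr0 m L : autocorr m L 0 = \sum_(u < L) m u ^+ 2.
Proof.
apply: eq_bigr => u _; rewrite (bigD1 u) //= distnn eqxx mulr1 big1 ?addr0 // => v.
by rewrite eq_sym -val_eqE distn_eq0 => /negPf ->; rewrite mulr0.
Qed.

Lemma autocorr_ge0 m L h : (forall u, 0 <= m u) -> 0 <= autocorr m L h.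
Proof.
by move=> m0; do 2!apply: sumr_ge0 => ? _; rewrite !mulr_ge0.
Qed.

(** Sum [2 * m u * m v <= m u ^+ 2 + m v ^+ 2] over the pairs at distance [h]; each index has at
    most two partners. *)
Lemma autocorr_le m L h : autocorr m L h <= 2 * autocorr m L 0.
Proof.
rewrite -(ler_pM2l (_ : 0 < 2 :> R)) //.
have sum_le : \sum_(u < L) \sum_(v < L) m u ^+ 2 * (`|u - v|%N == h)%:R
    <= 2 * autocorr m L 0.
  rewrite autocorr0 big_distrr /=; apply: ler_sum => u _.
  rewrite -big_distrr /= [leRHS]mulrC; apply: ler_wpM2l; first exact: sqr_ge0.
  exact: sum_ord_distn_le2.
apply: le_trans (_ : _ <= \sum_(u < L) \sum_(v < L) m u ^+ 2 * (`|u - v|%N == h)%:R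
   + \sum_(u < L) \sum_(v < L) m v ^+ 2 * (`|u - v|%N == h)%:R) _.
  rewrite -big_split big_distrr /=; apply: ler_sum => u _.
  rewrite -big_split big_distrr /=; apply: ler_sum => v _.
  rewrite -mulrDl mulrA ler_wpM2r // ?ler0n //.
  have := sqr_ge0 (m u - m v); lra.
rewrite [X in _ + X]exchange_big /=.
under [X in _ + X]eq_bigr => u _ do under eq_bigr => v _ do rewrite distnC.
lra.
Qed.

Lemma autocorr_cos m L t :
  \sum_(u < L) \sum_(v < L) m u * m v * cos (`|u - v|%N%:R * t) =
  \sum_(h < L) autocorr m L h * cos (h%:R * t).
Proof.
under [RHS]eq_bigr => h _ do rewrite big_distrl /=.
rewrite [RHS]exchange_big; apply: eq_bigr => u _ /=.
under [RHS]eq_bigr => h _ do rewrite big_distrl /=.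
rewrite [RHS]exchange_big; apply: eq_bigr => v _ /=.
have lt_uvL : (`|u - v| < L)%N by have := ltn_ord u; have := ltn_ord v; lia.
rewrite (bigD1 (Ordinal lt_uvL)) //= eqxx mulr1 big1 ?addr0 // => h.
by rewrite -val_eqE /= eq_sym => /negPf ->; rewrite mulr0 mul0r.
Qed.

(* [C] is the sequence of cosine coefficients of the [r]-th power of the Fejer
   kernel [|sum_(j < J) e(j t)|^2]; a large power makes it decay fast. *)
Lemma fejer_power r J : (0 < r)%N -> (0 < J)%N -> exists C : nat -> R,
  [/\ forall h, 0 <= C h <= 2 * C 0%N,
      (J ^ (2 * r))%:R <= (r * J)%:R * C 0%N,
      forall t, 0 <= \sum_(h < r * J) C h * cos (h%:R * t) &
      forall t, (\sum_(h < r * J) C h * cos (h%:R * t)) * (2 - 2 * cos t) ^+ r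
                <= 4 ^+ r].
Proof.
(* The kernel is the squared modulus of [p = g ^+ r] on the unit circle, hence nonnegative. *)
move=> r_gt0 J_gt0; pose g : {poly R} := \poly_(j < J) 1; pose p := g ^+ r.
have szp : (size p <= r * J)%N.
  apply: leq_trans (size_poly_exp_leq _ _) _.
  have := size_poly J (fun=> 1 : R); rewrite -/g; nia.
have p_ge0 u : 0 <= p`_u.
  rewrite /p; elim: (r) u => [|k IHk] u; first by rewrite expr0 coef1 ler0n.
  rewrite exprS coefM; apply: sumr_ge0 => i _; rewrite mulr_ge0 // coef_poly.
  by case: ifP.
have cosE t : \sum_(h < r * J) autocorr (fun u => p`_u) (r * J) h * cos (h%:R * t) =
    csqr (map_poly (real_complex R) g).[cis t] ^+ r.
  by rewrite -autocorr_cos -csqr_horner_cis // rmorphXn horner_exp csqrX.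
exists (autocorr (fun u => p`_u) (r * J)); split.
- by move=> h; rewrite autocorr_ge0 // autocorr_le.
(* [C 0] is the sum of the squared coefficients of [p]. The coefficients add up to [J ^ r], so
   Cauchy-Schwarz bounds it below. *)
- have p1 : \sum_(u < r * J) p`_u = J%:R ^+ r.
    transitivity p.[1].
      rewrite (horner_coef_wide 1 szp); apply: eq_bigr => i _.
      by rewrite expr1n mulr1.
    rewrite horner_exp horner_poly; congr (_ ^+ r).
    under eq_bigr => i _ do rewrite expr1n mulr1.
    by rewrite sumr_const card_ord.
  have := sqr_sum_le (enum 'I_(r * J)) (fun u => p`_u).
  by rewrite size_enum_ord !big_enum autocorr0 p1 -exprM mulnC natrX.
- by move=> t; rewrite cosE exprn_ge0 // addr_ge0 ?sqr_ge0.
- move=> t; rewrite cosE -exprMn -csqr_cis_sub1 -csqrM.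
  (* Geometric sum: [z ^ J - 1] has squared modulus at most 4 on the unit circle. *)
  have -> : (map_poly (real_complex R) g).[cis t] * (cis t - 1) = cis t ^+ J - 1.
    rewrite subrX1 mulrC; congr (_ * _); rewrite (@horner_coef_wide _ J).
      by apply: eq_bigr => i _; rewrite coef_map coef_poly ltn_ord; exact: mul1r.
    by rewrite size_map_poly size_poly.
  rewrite cisX csqr_cis_sub1 lerXn2r ?nnegrE //.
  by have := cos_geN1 (J%:R * t); lra.
Qed.

End Kernel.

(** * Orthogonality of cosines and Markov's inequality on [0, 1] *)

Section Integral.
Variable R : realType.
Local Notation mu := (@lebesgue_measure R).
Implicit Types (f g : R -> R) (x : R).

Lemma integrable01 f : continuous f -> mu.-integrable `[0, 1]%classic (EFin \o f).
Proof.
move=> cf; apply: continuous_compact_integrable; first exact: segment_compact.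
exact: continuous_subspaceT.
Qed.

Lemma continuous_sum (I : Type) (s : seq I) (f : I -> R -> R) :
  (forall i, continuous (f i)) -> continuous (fun x => \sum_(i <- s) f i x).
Proof.
by move=> cf; apply: continuous_big => [|i _]; [exact: add_continuous|exact: cf].
Qed.

Lemma Rintegral01_sum (I : Type) (s : seq I) (f : I -> R -> R) :
  (forall i, continuous (f i)) ->
  \int[mu]_(x in `[0, 1]) (\sum_(i <- s) f i x) =
  \sum_(i <- s) \int[mu]_(x in `[0, 1]) f i x.
Proof.
move=> cf; elim: s => [|i s IHs].
  under eq_Rintegral do rewrite big_nil; by rewrite big_nil Rintegral_cst // mul0r.
rewrite big_cons -IHs; under eq_Rintegral do rewrite big_cons.
rewrite RintegralD //; apply: integrable01 => //.
exact: continuous_sum.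
Qed.

Lemma continuous_cosM (k : R) : continuous (fun x => cos (k * (pi *+ 2 * x))).
Proof.
move=> x; apply: (@continuous_comp _ _ _ (fun x => k * (pi *+ 2 * x)) cos).
  by do 2!apply: cvgMl_tmp.
exact: continuous_cos.
Qed.

Lemma sin_nat2pi (n : nat) : sin (n%:R * (pi *+ 2)) = 0 :> R.
Proof.
have := periodicn (@sinD2pi R) n 0; rewrite add0r sin0 => <-.
by rewrite mulr_natl.
Qed.

Lemma Rintegral01_cos (n : nat) : (0 < n)%N ->
  \int[mu]_(x in `[0, 1]) cos (n%:R * (pi *+ 2 * x)) = 0.
Proof.
move=> n_gt0; pose w : R := n%:R * (pi *+ 2).
have w_neq0 : w != 0.
  by rewrite mulf_neq0 ?pnatr_eq0 -?lt0n // mulrn_eq0 /= gt_eqF ?pi_gt0.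
pose F x : R := w^-1 * sin (w * x).
have dF x : is_derive x 1 F (cos (w * x)).
  by apply: is_derive_eq; rewrite /GRing.scale /=; field.
have cF : continuous F.
  by move=> y; apply/differentiable_continuous/derivable1_diffP; case: (dF y).
rewrite /Rintegral; under eq_integral do rewrite mulrA -/w.
rewrite (@continuous_FTC2 _ _ F) //.
- by rewrite /F mulr1 mulr0 sin0 sin_nat2pi mulr0 sube0.
- apply: continuous_in_subspaceT => x _.
  have := @continuous_cosM n%:R x; congr (continuous_at _ _).
  by apply/funext => y; rewrite mulrA.
- by split => [x _| |]; [|apply: cvg_at_right_filter; exact: cF
     |apply: cvg_at_left_filter; exact: cF].
- by move=> x _; rewrite derive1E derive_val.
Qed.

(** Product-to-sum: only the difference frequency can vanish, and it does so exactly when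
    [m = n]. *)
Lemma Rintegral01_cosM (m n : nat) : (0 < m)%N -> (0 < n)%N ->
  \int[mu]_(x in `[0, 1]) (cos (m%:R * (pi *+ 2 * x)) * cos (n%:R * (pi *+ 2 * x)))
  = (m == n)%:R / 2.
Proof.
move=> m_gt0 n_gt0; pose f (i : nat) x : R := cos (i%:R * (pi *+ 2 * x)).
have -> : \int[mu]_(x in `[0, 1])
     (cos (m%:R * (pi *+ 2 * x)) * cos (n%:R * (pi *+ 2 * x))) =
   \int[mu]_(x in `[0, 1]) (2^-1 * (f `|m - n|%N x + f (m + n)%N x)).
  apply: eq_Rintegral => x _; rewrite /f; set t := pi *+ 2 * x.
  rewrite natrD mulrDl cosD.
  have -> : cos (`|m - n|%N%:R * t) = cos (m%:R * t - n%:R * t).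
    rewrite -mulrBl; have [le_mn|/ltnW le_nm] := leqP m n.
      by rewrite distnEr // natrB // -cosN -mulNr opprB.
    by rewrite distnEl // natrB.
  by rewrite cosB; field.
have cf i : continuous (f i) by exact: continuous_cosM.
have intf : mu.-integrable `[0, 1]%classic
    (EFin \o (fun x => f `|m - n|%N x + f (m + n)%N x)).
  by apply: integrable01 => x; apply: cvgD; exact: cf.
rewrite [LHS](RintegralZl 2^-1 _ intf) //.
rewrite (RintegralD _ (integrable01 (cf _)) (integrable01 (cf _))) //.
rewrite [X in _ + X]Rintegral01_cos ?addn_gt0 ?m_gt0 // addr0 mulrC; congr (_ / _).
have [->|ne_mn] := eqVneq m n; last by rewrite Rintegral01_cos // lt0n distn_eq0.
under eq_Rintegral do rewrite /f distnn mul0r cos0.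
have mu01 : mu `[0, 1]%classic = 1%E.
  by rewrite lebesgue_measure_itv /= lte_fin ltr01 sube0.
by rewrite Rintegral_cst // [X in fine X]mu01 mul1r.
Qed.

(** Frequencies may repeat. With frequencies [d * h], the surviving terms [n i = n j] are the
    solutions counted by [energy]. *)
Lemma Rintegral01_sqr_cos_sum (I : eqType) (s : seq I) (c : I -> R)
    (n : I -> nat) : {in s, forall i, (0 < n i)%N} ->
  \int[mu]_(x in `[0, 1]) ((\sum_(i <- s) c i * cos ((n i)%:R * (pi *+ 2 * x))) ^+ 2)
  = \sum_(i <- s) \sum_(j <- s) c i * c j * ((n i == n j)%:R / 2).
Proof.
move=> n_gt0; under eq_Rintegral do rewrite expr2 big_distrlr /=.
have ccos i : continuous (fun x => c i * cos ((n i)%:R * (pi *+ 2 * x))).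
  by move=> x; apply: cvgMl_tmp; exact: continuous_cosM.
rewrite Rintegral01_sum; last first.
  by move=> i; apply: continuous_sum => j x; apply: cvgM; exact: ccos.
apply: eq_big_seq => i /n_gt0 ni; rewrite Rintegral01_sum; last first.
  by move=> j x; apply: cvgM; exact: ccos.
apply: eq_big_seq => j /n_gt0 nj; under eq_Rintegral do rewrite mulrACA.
have intcos : mu.-integrable `[0, 1]%classic (EFin \o
    (fun x => cos ((n i)%:R * (pi *+ 2 * x)) * cos ((n j)%:R * (pi *+ 2 * x)))).
  by apply: integrable01 => x; apply: cvgM; exact: continuous_cosM.
by rewrite [LHS](RintegralZl _ _ intcos) // Rintegral01_cosM.
Qed.

Lemma markov01 f (a : R) : continuous f -> (forall x, 0 <= f x) -> 0 < a ->
  (mu (`[0%R, 1%R]%classic `&` [set x | (a <= f x)%R]) <=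
    (a^-1 * \int[mu]_(x in `[0, 1]) f x)%:E)%E.
Proof.
move=> cf f_ge0 a_gt0; pose D : set (measurableTypeR R) := `[0, 1]%classic.
rewrite -/D; have mD : measurable D by exact: measurable_itv.
have /integrableP[mf _] := integrable01 cf.
have /= := @le_integral_comp_abse _ _ _ mu D mD (EFin \o f) a id
  (@measurable_id _ _ _) (fun _ => id) (fun _ _ _ _ => id) mf a_gt0.
under eq_integral do rewrite ger0_norm //.
under eq_set do rewrite ger0_norm // lee_fin.
have -> : (\int[mu]_(x in D) (f x)%:E = (\int[mu]_(x in D) f x)%:E)%E.
  by rewrite /Rintegral fineK //; apply: integrable_fin_num => //; exact: integrable01.
by rewrite mulrC EFinM lee_pdivlMr // [(_ * a%:E)%E]muleC.
Qed.
End Integral.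

(** * The set where all multiples stay far from the integers *)

Section BadSet.
Variable R : realType.
Local Notation mu := (@lebesgue_measure R).
Implicit Types (x t : R).

(** Iterate [1 - cos (2 t) = 2 (1 - cos t) (1 + cos t) <= 4 (1 - cos t)]. Applied with
    [2 ^ k * t = pi], this bounds [1 - cos t] from below at a small angle. *)
Lemma one_sub_cos_double k t :
  1 - cos (2 ^+ k * t) <= 4 ^+ k * (1 - cos t).
Proof.
elim: k t => [|k IHk] t; first by rewrite !expr0 !mul1r.
rewrite exprSr -mulrA; apply: le_trans (IHk _) _.
rewrite exprSr -mulrA ler_wpM2l ?exprn_ge0 // mulr_natl cos_mulr2n.
have := cos_geN1 t; have := cos_le1 t; nra.
Qed.

Lemma cosD2piz t (z : int) : cos (t + pi *+ 2 * z%:~R) = cos t.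
Proof.
case: z => n; first by rewrite [_%:~R]/(n%:R) mulr_natr (periodicn (@cosD2pi R)).
rewrite NegzE mulrNz mulrN [_%:~R]/(n.+1%:R) mulr_natr.
by rewrite -(periodicn (@cosD2pi R) n.+1) subrK.
Qed.

Lemma cos_le_cos t u : 0 <= t -> t <= u -> u <= pi -> cos u <= cos t.
Proof.
move=> t0 tu upi; have [->//|ne] := eqVneq t u.
apply: ltW; rewrite ltr_cos ?in_itv /= ?t0 ?upi ?(le_trans t0 tu) ?(le_trans tu upi) //.
by rewrite lt_neqAle ne tu.
Qed.

(** Symmetry and monotonicity of cos reduce to the angle [2 pi / 2 ^ l]; after [l - 1] doublings it
    is [pi], where [1 - cos] equals 2. *)
Lemma distZ_gt_cos l x : 2 ^- l < distZ x ->
  16 / 4 ^+ l <= 2 - 2 * cos (pi *+ 2 * x).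
Proof.
rewrite /distZ lt_min; set y := x - _ => /andP[ly].
have -> : (Num.floor x)%:~R + 1 - x = 1 - y by rewrite /y; lra.
move=> ly1; have -> : cos (pi *+ 2 * x) = cos (pi *+ 2 * y).
  by rewrite -[RHS](cosD2piz _ (Num.floor x)) -mulrDr subrK.
have pi0 := pi_ge0 R.
have cosl : cos (pi *+ 2 * y) <= cos (pi *+ 2 * 2 ^- l).
  have l0 : 0 <= 2 ^- l :> R by rewrite invr_ge0 exprn_ge0.
  have [y2|y2] := lerP y 2^-1.
    apply: cos_le_cos.
    - by rewrite mulr_ge0 // mulrn_wge0.
    - by apply: ler_wpM2l; [exact: mulrn_wge0|exact: ltW].
    - by rewrite mulr2n; nra.
  have -> : cos (pi *+ 2 * y) = cos (pi *+ 2 * (1 - y)).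
    have -> : pi *+ 2 * (1 - y) = - (pi *+ 2 * y) + pi *+ 2 by ring.
    by rewrite cosD2pi cosN.
  apply: cos_le_cos.
  - by rewrite mulr_ge0 // mulrn_wge0.
  - by apply: ler_wpM2l; [exact: mulrn_wge0|exact: ltW].
  - by rewrite mulr2n; nra.
(* For [l = 0] the hypotheses clash: [y] and [1 - y] cannot both exceed 1. *)
case: l ly ly1 cosl => [|l] ly ly1 cosl; first by exfalso; move: ly ly1; rewrite expr0; lra.
have := one_sub_cos_double l (pi *+ 2 * 2 ^- l.+1).
have -> : 2 ^+ l * (pi *+ 2 * 2 ^- l.+1) = pi :> R.
  rewrite exprSr invfM -mulr_natr.
  by field; rewrite expf_neq0.
rewrite cospi => dbl; rewrite exprSr ler_pdivrMr ?mulr_gt0 ?exprn_gt0 //.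
have : 0 < 4 ^+ l :> R by rewrite exprn_gt0.
move: dbl cosl; set a := cos _; set b := cos _; set c := _ ^+ l; nra.
Qed.

(* The last hypothesis says that, outside the [2 ^- l]-neighbourhood of the
   integers, the kernel is at most half its mean. *)
Lemma far_measure (D : seq nat) (r J l : nat) :
  uniq D -> all (leq 1) D -> (0 < size D)%N -> (0 < r)%N -> (0 < J)%N ->
  (2 * (r * J) * 4 ^ (l * r) <= 4 ^ r * J ^ (2 * r))%N ->
  exists A : set R, [/\ measurable A,
    forall x, 0 <= x <= 1 -> {in D, forall d, 2 ^- l < distZ (d%:R * x)} -> A x &
    (mu A <= ((8 * energy D (iota 1 (r * J).-1))%:R / ((size D) ^ 2)%:R)%:E)%E].
Proof.
move=> uD D_gt0 sD r_gt0 J_gt0 HJ.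
have [C [C_le C0_ge G_ge0 G_le]] := @fejer_power R r J r_gt0 J_gt0.
set L := (r * J)%N in C0_ge G_ge0 G_le HJ *.
have L_gt0 : (0 < L)%N by rewrite muln_gt0 r_gt0.
pose Z := C 0%N; pose M : R := (size D)%:R.
have M_gt0 : 0 < M by rewrite ltr0n.
have L0 : 0 < L%:R :> R by rewrite ltr0n.
have Z_gt0 : 0 < Z.
  rewrite -(pmulr_rgt0 _ L0); apply: lt_le_trans C0_ge.
  by rewrite ltr0n expn_gt0 J_gt0.
(* [B = 4 ^ r / (16 / 4 ^ l) ^ r] is what [G_le] allows for the kernel where [distZ_gt_cos]
   applies. *)
pose B : R := (4 ^+ l / 4) ^+ r.
have BZ : 2 * B <= Z.
  rewrite -(ler_pM2l L0) -/Z; apply: le_trans C0_ge.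
  have -> : L%:R * (2 * B) = (2 * L * 4 ^ (l * r))%:R / 4 ^+ r :> R.
    rewrite /B expr_div_n -exprM !natrM natrX; ring.
  by rewrite ler_pdivrMr ?exprn_gt0 // mulrC -natrX -natrM ler_nat.
(* Starting [h] at 1 removes the mean [Z] of each kernel, so [T] has mean zero. *)
pose s := [seq (d, h) | d <- D, h <- iota 1 L.-1].
pose T x : R := \sum_(i <- s) C i.2 * cos ((i.1 * i.2)%N%:R * (pi *+ 2 * x)).
(* Each kernel value is at most [B <= Z / 2], so each [d] contributes at most [- (Z / 2)]. *)
have T_le x : {in D, forall d, 2 ^- l < distZ (d%:R * x)} -> T x <= - (M * Z / 2).
  move=> far.
  have TE : T x = \sum_(d <- D) (\sum_(h < L) C h * cos (h%:R * (pi *+ 2 * (d%:R * x))) - Z).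
    rewrite /T big_allpairs_dep /=; apply: eq_bigr => d _.
    rewrite -(big_mkord xpredT (fun h => C h * cos (h%:R * (pi *+ 2 * (d%:R * x))))).
    rewrite big_ltn // mul0r cos0 mulr1 addrC addKr /index_iota subn1.
    by apply: eq_bigr => h _; congr (_ * cos _); rewrite natrM; ring.
  rewrite TE; apply: (@le_trans _ _ (\sum_(d <- D) (- (Z / 2)))).
    rewrite big_seq [leRHS]big_seq; apply: ler_sum => d dD.
    have := G_le (pi *+ 2 * (d%:R * x)); set G := \sum_(h < L) _ => Gle.
    have G0 : 0 <= G by exact: G_ge0.
    have : G * (16 / 4 ^+ l) ^+ r <= 4 ^+ r.
      apply: le_trans Gle; apply: ler_wpM2l => //.
      have cl := distZ_gt_cos (far _ dD).
      have l0 : 0 <= 16 / 4 ^+ l :> R by rewrite divr_ge0 // exprn_ge0.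
      by rewrite lerXn2r // nnegrE // (le_trans l0).
    have -> : (16 / 4 ^+ l) ^+ r = 4 ^+ r / B :> R.
      by rewrite /B -expr_div_n; congr (_ ^+ r); field; rewrite expf_neq0.
    have B_gt0 : 0 < B by rewrite exprn_gt0 // divr_gt0 ?exprn_gt0.
    rewrite mulrCA ger_pMr ?exprn_gt0 // ler_pdivrMr // mul1r; lra.
  rewrite big_const_seq count_predT iter_addr_0 -mulr_natr -/M; lra.
have cT : continuous T.
  by apply: continuous_sum => i x; apply: cvgMl_tmp; exact: continuous_cosM.
have cT2 : continuous (fun x => T x ^+ 2) by move=> x; apply: cvgM; exact: cT.
pose a := (M * Z / 2) ^+ 2.
have a_gt0 : 0 < a by rewrite exprn_gt0 // divr_gt0 // mulr_gt0.
exists (`[0, 1]%classic `&` [set x | a <= T x ^+ 2]); split.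
- apply: measurableI; first exact: measurable_itv.
  apply: measurable_realfun.closed_measurable.
  by apply: (preimage_closed (D := [set y | a <= y])); [move=> x _; exact: cT2|exact: closed_ge].
- move=> x x01 /T_le Tx; split; first by rewrite /= in_itv.
  rewrite /= /a; have : 0 < M * Z / 2 by rewrite divr_gt0 // mulr_gt0.
  set b := M * Z / 2 in Tx *; nra.
- apply: le_trans (markov01 cT2 (fun x => sqr_ge0 _) a_gt0) _; rewrite lee_fin.
  rewrite Rintegral01_sqr_cos_sum; last first.
    move=> _ /allpairsP[[d h] [/= dD + ->]]; rewrite mem_iota /= => /andP[h_gt0 _].
    by rewrite muln_gt0 h_gt0 andbT; exact: (allP D_gt0).
  (* Each solution contributes at most [(2 Z) ^ 2 / 2]; dividing by [a = (M Z / 2) ^ 2] produces the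
     constant 8. *)
  apply: (@le_trans _ _ (a^-1 * (2 * Z ^+ 2 * (energy D (iota 1 L.-1))%:R))); last first.
    rewrite /a natrM natrX -/M le_eqVlt; apply/orP; left; apply/eqP.
    by field; rewrite !gt_eqF.
  rewrite ler_wpM2l ?invr_ge0 ?(ltW a_gt0) // /energy natr_sum big_distrr /=.
  rewrite big_allpairs_dep /=; apply: ler_sum => d _.
  rewrite natr_sum big_distrr /= exchange_big big_allpairs_dep /=.
  apply: ler_sum => e _; rewrite exchange_big natr_sum big_distrr /=.
  apply: ler_sum => h _; rewrite natr_sum big_distrr /=.
  apply: ler_sum => k _.
  have /andP[h0 h1] := C_le h; have /andP[k0 k1] := C_le k.
  rewrite mulrCA [leRHS]mulrC; apply: ler_wpM2l; first by rewrite ler0n.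
  have : C h * C k <= (2 * Z) * (2 * Z) by apply: ler_pM.
  lra.
Qed.

End BadSet.

(** * Choice of parameters at level [i] *)

(** The kernel length [J = 2 ^ ((q - 2) * i)] is shorter than [size D] by at least [4 ^ i]. One
    factor [2 ^ i] absorbs the loss of exponent [1 / p] in [energy_iota_le], for which [p >= 2 * q]
    suffices; the other is the gain. *)
Lemma energy_level_le (q : nat) : (2 < q)%N -> exists K, forall (D : seq nat) i,
  uniq D -> all (leq 1) D -> (2 ^ (q * i) <= size D)%N ->
  (energy D (iota 1 (q * 2 ^ ((q - 2) * i)).-1) * 2 ^ i <= K * size D ^ 2)%N.
Proof.
move=> q_gt2; pose s := (2 * q)%N; pose p := (2 ^ s)%N.
have le_qp : (2 * q <= p)%N by rewrite ltnW // ltn_expl.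
have [C C_le] := energy_iota_le s; exists (C * q ^ p.+1)%N => D i uD D_gt0 le_D.
set J := (2 ^ ((q - 2) * i))%N; set N := energy _ _; set M := size D.
have {}C_le : (N ^ p <= C * (M * (q * J)) ^ p.+1)%N.
  apply: leq_trans (C_le D _ uD D_gt0) _.
  by rewrite leq_mul2l leq_exp2r // leq_mul2l leq_pred !orbT.
have p_gt0 : (0 < p)%N by rewrite expn_gt0.
rewrite -(@leq_exp2r _ _ p) // expnMn.
apply: leq_trans (leq_mul C_le (leqnn _)) _.
have JM : (J ^ p.+1 * (2 ^ i) ^ p <= M ^ p.-1)%N.
  apply: leq_trans (_ : (2 ^ (q * i)) ^ p.-1 <= _)%N; last by case: (p.-1) => // n; rewrite leq_exp2r.
  rewrite /J -!expnM -expnD leq_pexp2l //.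
  have [q' qE] : exists q', q = q'.+2 by exists (q - 2)%N; lia.
  have [p' pE] : exists p', p = p'.+1 by exists p.-1; lia.
  rewrite qE subn2 pE /=; rewrite qE pE in le_qp; nia.
rewrite [((M * _) ^ _)%N]expnMn [((q * _) ^ _)%N]expnMn.
have -> : (C * (M ^ p.+1 * (q ^ p.+1 * J ^ p.+1)) * (2 ^ i) ^ p =
  (C * q ^ p.+1) * M ^ p.+1 * (J ^ p.+1 * (2 ^ i) ^ p))%N by ring.
apply: leq_trans (leq_mul (leqnn _) JM) _.
rewrite -mulnA -expnD (_ : p.+1 + p.-1 = 2 * p)%N; last by lia.
rewrite expnMn -expnM leq_mul2r; apply/orP; right.
case: (posnP (C * q ^ p.+1)) => [->//|K_gt0].
by rewrite -{1}[(C * _)%N]expn1 leq_pexp2l.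
Qed.

(** Use the [q]-th power of the kernel. Here [J] is [2 ^ i] times the inverse radius
    [2 ^ ((q - 3) * i)], so the kernel decays by [4 ^ (i * q)] off the neighbourhood; together with
    [4 ^ q] this beats the factor [2 * q * J]. *)
Lemma far_measure_level (R : realType) (q : nat) : (2 < q)%N ->
  exists K : R, 0 <= K /\ forall (D : seq nat) i,
  uniq D -> all (leq 1) D -> (2 ^ (q * i) <= size D)%N ->
  exists A : set R, [/\ measurable A,
    forall x, 0 <= x <= 1 ->
      {in D, forall d, 2 ^- ((q - 3) * i) < distZ (d%:R * x)} -> A x &
    (lebesgue_measure A <= (K / 2 ^+ i)%:E)%E].
Proof.
move=> q_gt2; have [K K_le] := energy_level_le q_gt2.
exists (8 * K%:R); split => [|D i uD D_gt0 le_D]; first by rewrite mulr_ge0.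
have sD : (0 < size D)%N by apply: leq_trans le_D; rewrite expn_gt0.
have [|||A [mA farA muA]] := @far_measure R D q (2 ^ ((q - 2) * i)) ((q - 3) * i) uD D_gt0 sD.
- by lia.
- by rewrite expn_gt0.
- have -> : ((q - 2) * i = (q - 3) * i + i)%N.
    by rewrite -mulSnr; congr (_ * _)%N; lia.
  set l := ((q - 3) * i)%N.
  have -> : ((2 ^ (l + i)) ^ (2 * q) = 4 ^ (l * q) * 4 ^ (i * q))%N.
    by rewrite -expnD -mulnDl (_ : 4 = 2 ^ 2)%N // -!expnM; congr (_ ^ _)%N; ring.
  rewrite [(4 ^ (l * q) * _)%N]mulnC !mulnA leq_mul2r; apply/orP; right.
  apply: leq_mul; first by apply: leq_trans (_ : 2 ^ q.*2 <= _)%N; [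
    rewrite mul2n ltnW // ltn_expl|rewrite -mul2n expnM].
  rewrite (_ : 4 = 2 ^ 2)%N // -expnM leq_exp2l // mul2n -addnn leq_add //.
    by rewrite /l mulnC leq_mul2l leq_subr orbT.
  by rewrite leq_pmulr; lia.
exists A; split=> //; apply: le_trans muA _; rewrite lee_fin.
rewrite ler_pdivrMr ?ltr0n ?expn_gt0 ?sD // mulrAC ler_pdivlMr ?exprn_gt0 //.
rewrite -natrX -!natrM ler_nat -!mulnA leq_mul2l; exact: K_le.
Qed.

(** * Positive differences of the sequence *)

(** As [n] stops at [m - 1], truncated subtraction is exact for an increasing sequence. *)
Definition posdiffs (a : nat -> nat) (N : nat) : seq nat :=
  undup [seq (a m - a n)%N | m <- iota 1 N, n <- iota 1 m.-1].

Section Differences.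
Variable a : nat -> nat.
Hypothesis a_inc : forall n m : nat, (0 < n)%N -> (n < m)%N -> (a n < a m)%N.

Lemma posdiffsP N d : reflect
  (exists m n, [/\ (0 < n)%N, (n < m)%N, (m <= N)%N & d = (a m - a n)%N])
  (d \in posdiffs a N).
Proof.
rewrite mem_undup; apply: (iffP allpairsPdep) => [[m [n [mN nm ->]]]|].
  by exists m, n; move: mN nm; rewrite !mem_iota => mN nm; split => //; lia.
move=> [m [n [n0 nm mN ->]]]; exists m, n.
by rewrite !mem_iota; split => //; lia.
Qed.

Lemma posdiffs_gt0 N : all (leq 1) (posdiffs a N).
Proof.
apply/allP => d /posdiffsP[m [n [n0 nm _ ->]]].
by rewrite subn_gt0 a_inc.
Qed.

Lemma posdiffs_sub M N : (M <= N)%N -> {subset posdiffs a M <= posdiffs a N}.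
Proof.
move=> le_MN d /posdiffsP[m [n [n0 nm mM ->]]]; apply/posdiffsP; exists m, n.
by split => //; exact: leq_trans le_MN.
Qed.

(** The differences [a k - a 1] with [2 <= k <= N] are distinct. Hence every level is eventually
    reached. *)
Lemma size_posdiffs_ge N : (N.-1 <= size (posdiffs a N))%N.
Proof.
rewrite -{1}[N.-1](size_iota 2) -(size_map (fun k => (a k - a 1)%N)).
apply: uniq_leq_size => [|_ /mapP[k kN ->]].
  rewrite map_inj_in_uniq ?iota_uniq // => j k; rewrite !mem_iota => jN kN eq_jk.
  have a1j : (a 1 < a j)%N by apply: a_inc; lia.
  have a1k : (a 1 < a k)%N by apply: a_inc; lia.
  have [lt_jk|lt_kj|//] := ltngtP j k.
    by have : (a j < a k)%N by [apply: a_inc; lia]; lia.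
  by have : (a k < a j)%N by [apply: a_inc; lia]; lia.
by apply/posdiffsP; exists k, 1%N; move: kN; rewrite mem_iota => kN; split => //; lia.
Qed.

Lemma size_posdiffs_le N : (size (posdiffs a N) <= N ^ 2)%N.
Proof.
have -> : (N ^ 2 = size [seq (a m - a n)%N | m <- iota 1 N, n <- iota 1 N])%N.
  by rewrite size_allpairs size_iota.
apply: uniq_leq_size => [|d /posdiffsP[m [n [n0 nm mN ->]]]]; first exact: undup_uniq.
by apply/allpairsP; exists (m, n); rewrite !mem_iota /=; split => //; lia.
Qed.

(** Each difference is 0, [d] or [- d] with [d] in [posdiffs a N]. *)
Lemma C_N_le N : (C_N a N <= (2 * size (posdiffs a N)).+1)%N.
Proof.
pose s := posdiffs a N; pose t : seq int := 0 :: [seq d%:Z | d <- s] ++ [seq - d%:Z | d <- s].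
have -> : ((2 * size s).+1 = size t)%N by rewrite /= size_cat !size_map mul2n addnn.
apply: uniq_leq_size => [|z]; first exact: undup_uniq.
rewrite mem_undup => /allpairsP[[m n] /= []]; rewrite !mem_iota => mN nN ->.
rewrite inE mem_cat; have [lt_mn|lt_nm|->] := ltngtP m n; last by rewrite subrr eqxx.
  have lt_a : (a m < a n)%N by apply: a_inc => //; lia.
  apply/orP; right; apply/orP; right; apply/mapP; exists (a n - a m)%N.
    by apply/posdiffsP; exists n, m; split => //; lia.
  by lia.
have lt_a : (a n < a m)%N by apply: a_inc => //; lia.
apply/orP; right; apply/orP; left; apply/mapP; exists (a m - a n)%N.
  by apply/posdiffsP; exists m, n; split => //; lia.
by lia.
Qed.

Lemma C_N_gt0 N : (0 < N)%N -> (0 < C_N a N)%N.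
Proof.
move=> N_gt0; have : (a 1)%:Z - (a 1)%:Z \in
    undup [seq (a m)%:Z - (a n)%:Z | m <- iota 1 N, n <- iota 1 N].
  by rewrite mem_undup; apply/allpairsP; exists (1%N, 1%N); rewrite !mem_iota /= add1n ltnS N_gt0.
by rewrite /C_N; case: (undup _).
Qed.

Lemma delta_min_le (R : realType) (alpha : R) N d : d \in posdiffs a N ->
  delta_min a alpha N <= distZ (d%:R * alpha).
Proof.
move=> /posdiffsP[m [n [n0 nm mN ->]]].
rewrite /delta_min; apply: (@bigmin_inf_seq _ _ _ _ _ m) => //.
  by rewrite mem_iota; lia.
apply: (@bigmin_inf_seq _ _ _ _ _ n) => //.
- by rewrite mem_iota; lia.
- by rewrite gtn_eqF.
- by rewrite natrB // ltnW // a_inc.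
Qed.

End Differences.

(** * Borel-Cantelli and conclusion *)

Lemma nneseries_geometric_lt_pinfty (R : realType) (u : nat -> \bar R) (K : R) :
  0 <= K -> (forall i, 0 <= u i)%E -> (forall i, u i <= (K / 2 ^+ i)%:E)%E ->
  (\sum_(i <oo) u i < +oo)%E.
Proof.
move=> K0 u0 uK; apply: le_lt_trans (ltry (2 * K)).
have K20 : 0 <= 2 * K by rewrite mulr_ge0.
apply: le_trans (epsilon_trick0 xpredT K20); apply: lee_nneseries => // i _.
apply: le_trans (uK i) _; rewrite lee_fin le_eqVlt; apply/orP; left; apply/eqP.
by rewrite expnS natrM natrX; field; rewrite expf_neq0.
Qed.

(** From [2 ^ (q * i) <= S <= N ^ 2] and [8 <= q * eps] follows [2 ^ (4 * i) <= N ^ eps], while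
    [c <= 2 ^ (q * (i + 1) + 1)]. The exponents compare as [q * (i + 1) + 1 <= (q - 3) * i + 4 * i],
    true once [i > q]. *)
Lemma level_bound (R : realType) (eps : R) (q i N S c : nat) :
  8 <= q%:R * eps -> (q.+2 <= i)%N -> (2 < q)%N ->
  (2 ^ (q * i) <= S)%N -> (S < 2 ^ (q * i.+1))%N -> (S <= N ^ 2)%N ->
  (0 < c)%N -> (c <= (2 * S).+1)%N ->
  2 ^- ((q - 3) * i) <= N%:R `^ eps / c%:R :> R.
Proof.
move=> qeps le_qi q_gt2 S_ge S_lt S_le c_gt0 c_le.
have N_ge : 2 ^+ (4 * i) <= N%:R `^ eps :> R.
  have -> : eps = 2%:R * (eps / 2) by field.
  rewrite powRrM powR_mulrn //.
  have eps0 : 0 <= eps / 2.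
    rewrite divr_ge0 //; have q0 : 0 <= q%:R :> R by [].
    by rewrite leNgt; apply/negP => ?; nra.
  apply: le_trans (ge0_ler_powR eps0 _ _ (_ : (2 ^+ (q * i) : R) <= _)); last first.
  - by rewrite -!natrX ler_nat (leq_trans S_ge).
  - by rewrite nnegrE exprn_ge0.
  - by rewrite nnegrE exprn_ge0.
  rewrite -!powR_mulrn // -powRrM; apply: ler_powR; first by rewrite ler1n.
  rewrite !natrM; have : 0 <= i%:R :> R by []; nra.
rewrite ler_pdivlMr ?ltr0n //; apply: le_trans N_ge.
rewrite mulrC ler_pdivrMr ?exprn_gt0 // -!natrX -natrM ler_nat -expnD.
have lt2S : ((2 * S).+1 <= 2 ^ (q * i.+1).+1)%N by rewrite expnS; lia.
apply: leq_trans c_le (leq_trans lt2S _); rewrite leq_exp2l //.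
have [q' qE] : exists q', q = q'.+3 by exists (q - 3)%N; lia.
by rewrite qE in le_qi *; rewrite (_ : q'.+3 - 3 = q')%N; nia.
Qed.

Unset Implicit Arguments.

Theorem theorem2 (R : realType) (a : nat -> nat)
  (ha_pos : forall n : nat, (0 < n)%N -> (0 < a n)%N)
  (ha_inc : forall n m : nat, (0 < n)%N -> (n < m)%N -> (a n < a m)%N)
  (eps : R) (heps : 0 < eps) :
  (@lebesgue_measure R).-negligible
    [set alpha : R | (0 <= alpha <= 1) /\
       ~ (exists N0 : nat, forall N : nat, (N0 <= N)%N ->
            delta_min a alpha N <= (N%:R `^ eps) / (C_N a N)%:R)].
Proof.
have [q q_gt2 qeps] : exists2 q, (2 < q)%N & 8 <= q%:R * eps.
  exists (Num.truncn (8 / eps)).+3 => //.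
  rewrite -ler_pdivrMr //; apply: le_trans (ltW (truncnS_gt _)) _.
  by rewrite ler_nat ltnW.
have [K [K0 level]] := @far_measure_level R q q_gt2.
have exN i : exists N, (2 ^ (q * i) <= size (posdiffs a N))%N.
  exists (2 ^ (q * i)).+1; exact: size_posdiffs_ge.
(* [Nn i] is the first [N] with [2 ^ (q * i)] positive differences; the exceptional set of level [i]
   is built for this [N] alone. *)
pose Nn i := ex_minn (exN i).
have NnP i : (2 ^ (q * i) <= size (posdiffs a (Nn i)))%N.
  by rewrite /Nn; case: ex_minnP.
have Nn_min i N : (2 ^ (q * i) <= size (posdiffs a N))%N -> (Nn i <= N)%N.
  by rewrite /Nn; case: ex_minnP => n _; apply.
have [A AP] := choice (fun i =>
  level _ i (undup_uniq _) (posdiffs_gt0 ha_inc (Nn i)) (NnP i)).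
have mA i : measurable (A i) by case: (AP i).
exists (lim_sup_set A); split.
- apply: bigcapT_measurable => n; apply: bigcup_measurable => k _; exact: mA.
- apply: lim_sup_set_cvg0 => //; apply: (nneseries_geometric_lt_pinfty K0) => // i.
  by case: (AP i).
(* By contraposition: if [alpha] avoids [A i] for all [i >= i0], the bound holds for all large
   [N]. *)
move=> alpha /= [alpha01 bad] i0 _; apply: contrapT => notA; apply: bad.
(* [q.+2] serves [level_bound]; the successor in the threshold offsets [N.-1] in
   [size_posdiffs_ge]. *)
pose i1 := maxn i0 q.+2; exists (2 ^ (q * i1)).+1 => N le_N.
pose S := size (posdiffs a N).
have S_ge : (2 ^ (q * i1) <= S)%N.
  by apply: leq_trans (size_posdiffs_ge ha_inc N); lia.
have S_gt0 : (0 < S)%N by apply: leq_trans S_ge; rewrite expn_gt0.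
(* [i] is the level of [N], determined by [2 ^ (q * i) <= S < 2 ^ (q * (i + 1))]. *)
pose t := trunc_log 2 S; pose i := (t %/ q)%N.
have q_gt0 : (0 < q)%N by lia.
have /andP[t_le t_gt] := trunc_log_bounds (isT : (1 < 2)%N) S_gt0.
have le_i1 : (i1 <= i)%N.
  by rewrite leq_divRL // mulnC; exact: trunc_log_max.
have S_ge' : (2 ^ (q * i) <= S)%N.
  by apply: leq_trans t_le; rewrite leq_exp2l // mulnC leq_divM.
have S_lt : (S < 2 ^ (q * i.+1))%N.
  by apply: leq_trans t_gt _; rewrite leq_exp2l // mulnC ltn_ceil.
have [_ far _] := AP i.
have [d dD near_d] : exists2 d, d \in posdiffs a (Nn i) &
    distZ (d%:R * alpha) <= 2 ^- ((q - 3) * i).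
  apply: contrapT => no_d; apply: notA; exists i => /=.
    by apply: leq_trans le_i1; exact: leq_maxl.
  apply: far => // d dD; rewrite ltNge; apply/negP => le_d; apply: no_d.
  by exists d.
(* The close difference found at [Nn i] is still a difference at [N >= Nn i]. *)
apply: le_trans (delta_min_le ha_inc alpha (posdiffs_sub (Nn_min _ _ S_ge') dD)) _.
apply: le_trans near_d (level_bound qeps _ q_gt2 S_ge' S_lt _ _ _).
- by apply: leq_trans le_i1; exact: leq_maxr.
- exact: size_posdiffs_le.
- by apply: C_N_gt0; lia.
- exact: C_N_le.
Qed.
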